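(* Let $\tau:\mathcal D\to\mathcal D$ be a rearrangement and $T$ the induced operator $Th_I=h_{\tau(I)}$. The following are equivalent: (i) $T$ is an isomorphism of dyadic $\mathrm{BMO}$ into itself, i.e. there is $c\ge1$ with $c^{-1}\|x\|\le\|Tx\|\le c\|x\|$ for all $x\in\mathrm{BMO}$; (ii) there exists $M\ge 0$ such that for every $\mathcal L\subset\mathcal D$, $M^{-1}[\![\mathcal L]\!]\le[\![\tau(\mathcal L)]\!]\le M[\![\mathcal L]\!]$; (iii) $\tau$ and $\tau^{-1}$ both satisfy Property $\mathcal P$.
   Context: $\mathcal D$ is the collection of dyadic subintervals of $[0,1]$. A rearrangement is an injective map $\tau:\mathcal D\to\mathcal D$; $\tau^{-1}$ denotes its inverse, defined on $\tau(\mathcal D)$. For $I\in\mathcal D$, $h_I$ is the $L^\infty$-normalized Haar function ($h_I=1$ on the left half of $I$, $-1$ on the right half, $0$ outside $I$). For $x=\sum x_Ih_I$, the dyadic BMO norm is $\|x\|=\sup_{J\in\mathcal D}\big(\frac1{|J|}\sum_{I\subseteq J}x_I^2|I|\big)^{1/2}$, and $\mathrm{BMO}$ is the space of such $x$ with $\|x\|<\infty$. For $\mathcal L\subset\mathcal D$, the Carleson constant is $[\![\mathcal L]\!]=\sup_{J\in\mathcal D}\frac1{|J|}\sum_{I\in\mathcal L,I\subseteq J}|I|$; $\mathcal L$ satisfies the $M$ Carleson condition if $[\![\mathcal L]\!]\le M$. $\mathcal L^*=\bigcup_{I\in\mathcal L}I$, and for $J\in\mathcal D$, $\mathcal L\cap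 J=\{I\in\mathcal L: I\subseteq J\}$. Property $\mathcal P$: a rearrangement $\tau$ satisfies Property $\mathcal P$ if there is $M>0$ such that for each $J\in\mathcal D$ the collection $\tau(\mathcal D)\cap J$ can be written as a disjoint union $\bigcup_i\tau(\mathcal L_i)\cup\bigcup_i\mathcal E_i$ (with $\mathcal L_i\subset\mathcal D$, $i\in\mathbb N$) such that (a) $\bigcup_i\mathcal E_i$ satisfies the $M$ Carleson condition; (b) $\frac{|\tau(I)|}{|I|}\le M\frac{|\tau(\mathcal L_i)^*|+|\mathcal E_i^*|}{|\mathcal L_i^*|}$ whenever $I\in\mathcal L_i$, $i\in\mathbb N$; (c) $\sum_{i}|\tau(\mathcal L_i)^*|\le M|J|$. For $\tau^{-1}$ the same definition is used with $\tau^{-1}$ in place of $\tau$ (so $\tau^{-1}(\tau(\mathcal D))\cap J=\mathcal D\cap J$ is decomposed, with $\mathcal L_i\subset\tau(\mathcal D)$). *)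

(* Defs.v *)
From HB Require Import structures.
From mathcomp Require Import all_boot all_order all_algebra.
From mathcomp Require Import all_classical all_reals all_analysis.
Set Implicit Arguments. Unset Strict Implicit. Unset Printing Implicit Defensive.
Import Order.TTheory GRing.Theory Num.Theory.
Local Open Scope classical_set_scope.
Local Open Scope ring_scope.

(* A dyadic subinterval of [0,1]: the pair (n,k), k < 2^n, stands for
   I = [k 2^-n, (k+1) 2^-n). *)
Definition dyad := {p : nat * nat | (p.2 < 2 ^ p.1)%N}.

Section Dyadic.
Variable R : realType.

Definition itv (I : dyad) : set R :=
  [set t : R | ((val I).2%:R / 2 ^+ (val I).1 <= t) &&
               (t < ((val I).2.+1)%:R / 2 ^+ (val I).1)].

Definition len (I : dyad) : R := (2 ^+ (val I).1)^-1.

Definition subd (I J : dyad) : Prop := itv I `<=` itv J.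

Definition star (L : set dyad) : R :=
  fine (lebesgue_measure (\bigcup_(I in L) itv I)).

Definition carleson (L : set dyad) : \bar R :=
  ereal_sup [set (((len J)^-1)%:E *
                 (\esum_(I in [set I | L I /\ subd I J]) (len I)%:E))%E
            | J in [set: dyad]].

Definition esqrt (y : \bar R) : \bar R :=
  match y with
  | r%:E => (Num.sqrt r)%:E
  | +oo%E => +oo%E
  | -oo%E => 0%E
  end.

(* dyadic BMO norm of x = sum_I x_I h_I, coefficients x : dyad -> R *)
Definition bmo_norm (x : dyad -> R) : \bar R :=
  ereal_sup [set esqrt (((len J)^-1)%:E *
                 (\esum_(I in [set I | subd I J]) ((x I) ^+ 2 * len I)%:E))%E
            | J in [set: dyad]].

(* the inverse tau^{-1}, defined on tau(D) (arbitrary value elsewhere) *)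
Definition tau_inv (tau : dyad -> dyad) (K : dyad) : dyad :=
  match pselect (exists I, tau I = K) with
  | left e => projT1 (cid e)
  | right _ => K
  end.

(* the operator T h_I = h_{tau(I)} acting on coefficient sequences *)
Definition Top (tau : dyad -> dyad) (x : dyad -> R) (K : dyad) : R :=
  match pselect (exists I, tau I = K) with
  | left e => x (projT1 (cid e))
  | right _ => 0
  end.

(* Property P for a partial injective map sigma defined on Dom
   (Dom = D and sigma = tau, or Dom = tau(D) and sigma = tau^{-1}). *)
Definition propP (Dom : set dyad) (sigma : dyad -> dyad) : Prop :=
  exists M : R, 0 < M /\
  forall J : dyad, exists (Ls Es : nat -> set dyad),
    (forall i, Ls i `<=` Dom) /\
    [set K | (exists2 I, Dom I & sigma I = K) /\ subd K J] =
      (\bigcup_i (sigma @` Ls i)) `|` (\bigcup_i Es i) /\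
    (forall i j, i <> j -> (sigma @` Ls i) `&` (sigma @` Ls j) = set0) /\
    (forall i j, i <> j -> Es i `&` Es j = set0) /\
    (forall i j, (sigma @` Ls i) `&` Es j = set0) /\
    (carleson (\bigcup_i Es i) <= M%:E)%E /\
    (forall i I, Ls i I ->
       len (sigma I) / len I <=
         M * (star (sigma @` Ls i) + star (Es i)) / star (Ls i)) /\
    (\sum_(i <oo) (star (sigma @` Ls i))%:E <= (M * len J)%:E)%E.

End Dyadic.

(* Main.v *)
(* Let sigma : Dom -> D be injective and put, for a weight w >= 0,
   A(w) = sup_J |J|^-1 sum_(I <= J) w_I |I|; A(1_L) is the Carleson constant
   of L and A(x^2) is the square of the BMO norm of x.

   (iii) => (i).  Property P bounds A(w o sigma^-1) by A(w).  On sigma(L_i),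
   (b) and sum_(I in L_i) w_I |I| <= A(w) |L_i^*| give
   sum_(I in L_i) w_I |sigma I| <= M A(w) (|sigma(L_i)^*| + |E_i^*|), which (c)
   and (a) sum up to a multiple of |J|; on the E_i one uses w <= A(w) and (a).

   (i) => (ii).  Take x = 1_L, with L finite for the lower bound.

   (ii) => (iii).  Given J, let C_k collect the I with sigma I <= J and
   4^k <= |sigma I| / |I| < 4^(k+1), and take L_i = C_k, E_i = set0.  The maximal
   intervals of C_k, and those of sigma(C_k), have Carleson constant at most 1,
   so 4^k |C_k^*| and |sigma(C_k)^*| are comparable; this is (b), and reduces (c)
   to sum_k 4^k |C_k^*| <= const |J|.  Call I maximal in C_k good if at most half
   of it is covered by U_k, the union of the C_j^* with j > k.  The sets I \ U_k,
   for I good, are disjoint, so the good intervals have Carleson constant at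
   most 2 and contribute at most 2M|J|.  The bad ones have total length at most
   2 |U_k|, and their contribution is absorbed by a geometric series. *)
Require Import Defs.
From HB Require Import structures.
From mathcomp Require Import all_boot all_order all_algebra.
From mathcomp Require Import all_classical all_reals all_analysis.
From mathcomp Require Import zify ring lra.
Import Order.TTheory GRing.Theory Num.Theory.
Local Open Scope classical_set_scope.
Local Open Scope ring_scope.

Section Rearrangements.
Set Implicit Arguments.
Unset Strict Implicit.
Variable R : realType.
Local Notation mu := (@lebesgue_measure R).
Local Notation itv := (@Defs.itv).

(** * Sums over countable sets *)

(** Both sides are sums over the pairs [(f i, i)] with [i] in [L]. *)
Lemma esum_fibers (T T' : choiceType) (L : set T) (P : set T') (f : T -> T')
    (a : T -> \bar R) :
  (forall i, L i -> P (f i)) -> (forall i, L i -> (0 <= a i)%E) ->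
  (\esum_(i in L) a i =
   \esum_(j in P) \esum_(i in [set i | L i /\ f i = j]) a i)%E.
Proof.
move=> fP a0; rewrite esum_esum; last by move=> j i _ [] /a0.
apply: (reindex_esum _ _ snd); split.
- by move=> [j i] [_ []].
- by move=> [j i] [j' i'] /[!inE] -[_ [_ /= <-]] [_ [_ /= <-]] /= ->.
- by move=> i Li; exists (f i, i) => //; split => //=; exact: fP.
Qed.

Lemma esumZl (T : choiceType) (L : set T) (c : R) (a : T -> \bar R) :
  0 <= c -> (forall i, L i -> (0 <= a i)%E) ->
  (\esum_(i in L) (c%:E * a i) = c%:E * \esum_(i in L) a i)%E.
Proof.
rewrite le_eqVlt => /predU1P[<- _|c0 a0].
  by rewrite mul0e esum1// => i _; rewrite mul0e.
(* This inequality suffices: the reverse one is its instance for the factor [c^-1] and the terms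
   [c%:E * a i]. *)
have le k (b : T -> \bar R) : 0 <= k -> (forall i, L i -> (0 <= b i)%E) ->
    (\esum_(i in L) (k%:E * b i) <= k%:E * \esum_(i in L) b i)%E.
  move=> k0 b0; apply: ge_ereal_sup => _ [X [finX XL] <-].
  rewrite (_ : \sum_(i \in X) _ = k%:E * \sum_(i \in X) b i)%E.
    by rewrite lee_wpmul2l ?lee_fin//; apply: ereal_sup_ubound; exists X.
  rewrite !fsbig_finite//= big_seq [in RHS]big_seq ge0_sume_distrr//.
  by move=> i; rewrite in_fset_set// inE => /XL /b0.
apply/eqP; rewrite eq_le le//=; last exact: ltW.
have c1 : (0 <= c^-1) by rewrite invr_ge0 ltW.
rewrite -lee_pdivlMl//.
rewrite [leLHS](eq_esum (b := fun i => c^-1%:E * (c%:E * a i))%E).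
  by apply: le => // i Li; rewrite mule_ge0 ?a0// lee_fin ltW.
by move=> i _; rewrite muleA -EFinM mulVf ?gt_eqF// mul1e.
Qed.

Lemma le_esum_set (T : choiceType) (A B : set T) (a : T -> \bar R) :
  A `<=` B -> (\esum_(i in A) a i <= \esum_(i in B) a i)%E.
Proof.
move=> AB; apply: ge_ereal_sup => _ [X [finX XA] <-].
by apply: ereal_sup_ubound; exists X => //; split=> //; exact: subset_trans AB.
Qed.

(** Codes without a preimage in [L] contribute the empty set, so results on sequences of sets apply
    to unions over a countable type. *)
Lemma bigcup_unpickle (S : Type) (T : countType) (L : set T) (F : T -> set S) :
  \bigcup_(i in L) F i =
  \bigcup_n oapp (fun i => if i \in L then F i else set0) set0 (@pickle_inv T n).
Proof.
apply/seteqP; split=> [x [i Li Fix]|x [n _]].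
  by exists (pickle i) => //; rewrite pickleK_inv /= mem_set.
case: (pickle_inv n) => //= i; case: ifPn => // /[!inE] Li Fix; by exists i.
Qed.

Section Measure.
Context d (S : measurableType d) (mu : {measure set S -> \bar R}).
Variables (T : countType) (L : set T) (F : T -> set S).
Hypothesis mF : forall i, L i -> measurable (F i).

Lemma measurable_bigcup_count : measurable (\bigcup_(i in L) F i).
Proof.
rewrite bigcup_unpickle; apply: bigcupT_measurable => n.
case: (pickle_inv n) => //= i; case: ifPn => // /[!inE]; exact: mF.
Qed.

Lemma measure_bigcup_le_esum :
  (mu (\bigcup_(i in L) F i) <= \esum_(i in L) mu (F i))%E.
Proof.
have := measurable_bigcup_count; rewrite bigcup_unpickle.
set G := fun n => oapp _ _ _ => mG.
apply: (le_trans (generalized_Boole_inequality _ _ mG)).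
  move=> n; rewrite /G; case: (pickle_inv n) => //= i.
  by case: ifPn => // /[!inE]; exact: mF.
rewrite nneseries_esumT//.
rewrite (eq_esum (b := fun i => mu (G (pickle i)))); last first.
  by move=> i Li; rewrite /G pickleK_inv /= mem_set.
rewrite -(esum_image L pickle (fun n => mu (G n))); last first.
  by move=> i j _ _; exact: (pcan_inj (@pickleK T)).
rewrite [leRHS]esum_mkcond; apply: le_esum => n _.
case: ifPn => // nL; rewrite /G.
case E : (pickle_inv n) => [i|] /=; last by rewrite measure0.
case: ifPn => [/[!inE] Li|_]; last by rewrite measure0.
exfalso; move/negP: nL; apply; rewrite inE; exists i => //.
by have := @pickle_invK T n; rewrite E.
Qed.

Lemma esum_measure_le (B : set S) : trivIset L F -> measurable B ->
  (forall i, L i -> F i `<=` B) -> (\esum_(i in L) mu (F i) <= mu B)%E.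
Proof.
move=> tF mB FB; apply: ge_ereal_sup => _ [X [finX XL] <-].
have mFX i : X i -> measurable (F i) by move=> /XL /mF.
rewrite -content_fin_bigcup//; last 2 first.
- exact: sub_trivIset tF.
- exact: fin_bigcup_measurable.
apply: le_measure; rewrite ?inE//; first exact: fin_bigcup_measurable.
by move=> x [i /XL Li]; exact: FB.
Qed.
End Measure.

(** * Maximal dyadic intervals *)

Definition lvl (I : dyad) : nat := (val I).1.

Lemma len_gt0 I : 0 < len R I. Proof. by rewrite invr_gt0 exprn_gt0. Qed.

Lemma len_ge0 I : 0 <= len R I. Proof. exact/ltW/len_gt0. Qed.

Lemma measurable_dyad I : measurable (itv R I).
Proof.
rewrite (_ : itv R I =
  [set` `[(val I).2%:R / 2 ^+ (lvl I), ((val I).2.+1)%:R / 2 ^+ (lvl I)[%R])//.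
Qed.

Lemma lebesgue_measure_dyad I : mu (itv R I) = (len R I)%:E.
Proof.
rewrite (_ : itv R I =
  [set` `[(val I).2%:R / 2 ^+ (lvl I), ((val I).2.+1)%:R / 2 ^+ (lvl I)[%R])//.
have p0 : (0 : R) < 2 ^+ lvl I by rewrite exprn_gt0.
rewrite lebesgue_measure_itv /= lte_fin ltr_pM2r ?invr_gt0// ltr_nat ltnSn.
by rewrite EFinN -EFinD -mulrBl -natrB// subSnn mul1r.
Qed.

Lemma lebesgue_measure_dyads_fin (L : set dyad) :
  mu (\bigcup_(I in L) itv R I) \is a fin_num.
Proof.
have ge0 : (0 <= mu (\bigcup_(I in L) itv R I))%E by [].
rewrite ge0_fin_numE//.
apply: (@le_lt_trans _ _ (mu [set` `[0, 1[%R])); last first.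
  by rewrite lebesgue_measure_itv /= lte_fin ltr01 oppr0 adde0 ltry.
apply: le_measure; rewrite ?inE.
- by apply: measurable_bigcup_count => I _; exact: measurable_dyad.
- exact: measurable_itv.
move=> x [I _ /andP[xl xr]] /=; rewrite in_itv /=; apply/andP; split.
  by apply: le_trans xl; rewrite mulr_ge0.
apply: (lt_le_trans xr); rewrite ler_pdivrMr ?exprn_gt0// mul1r -natrX ler_nat.
exact: (valP I).
Qed.

Lemma starE (L : set dyad) :
  (star R L)%:E = mu (\bigcup_(I in L) itv R I).
Proof. by rewrite fineK// lebesgue_measure_dyads_fin. Qed.

(** Over the common denominator [2 ^+ n], the shared point [x] forces
    [j * 2 ^ d <= k < j.+1 * 2 ^ d] between integers, which is nesting. *)
Lemma itv_meet I J x : (lvl J <= lvl I)%N -> itv R I x -> itv R J x ->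
  itv R I `<=` itv R J /\ (lvl I = lvl J -> I = J).
Proof.
case: I J => -[n k] kn [[m j] jm]; rewrite /lvl /itv /= => mn.
have [d dE] : exists d, n = (m + d)%N by exists (n - m)%N; rewrite subnKC.
have p0 a : (0 : R) < 2 ^+ a by rewrite exprn_gt0.
have E (i : nat) : i%:R / 2 ^+ m = (i * 2 ^ d)%:R / 2 ^+ n :> R.
  by rewrite dE exprD natrM natrX; field; rewrite !gt_eqF.
rewrite !E => /andP[kx xk] /andP[jx xj].
have jk : (j * 2 ^ d <= k)%N.
  have := le_lt_trans jx xk.
  by rewrite ltr_pM2r ?invr_gt0// ltr_nat ltnS.
have kj : (k < j.+1 * 2 ^ d)%N.
  have := le_lt_trans kx xj.
  by rewrite ltr_pM2r ?invr_gt0// ltr_nat.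
split=> [y|nm].
  move=> /andP[ky yk]; apply/andP; split.
    by apply: le_trans ky; rewrite ler_pM2r ?invr_gt0// ler_nat.
  by apply: (lt_le_trans yk); rewrite ler_pM2r ?invr_gt0// ler_nat.
have d0 : d = 0%N by lia.
apply: val_inj => /=; move: jk kj; rewrite d0 expn0 !muln1 nm => jk kj.
by congr pair; lia.
Qed.

Lemma dyad_nonempty I : itv R I ((val I).2%:R / 2 ^+ (lvl I)).
Proof.
by apply/andP; split=> //; rewrite ltr_pM2r ?invr_gt0 ?exprn_gt0// ltr_nat.
Qed.

Lemma subd_len I J : subd R I J -> len R I <= len R J.
Proof.
move=> IJ; rewrite -lee_fin -!lebesgue_measure_dyad le_measure// inE;
exact: measurable_dyad.
Qed.

Lemma subd_lvl I J : subd R I J -> (lvl J <= lvl I)%N.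
Proof.
move/subd_len; rewrite /len -!/(lvl _) lef_pV2 ?posrE ?exprn_gt0//.
by rewrite ler_eXn2l// ltr1n.
Qed.

Definition maxd (L : set dyad) : set dyad :=
  [set I | L I /\ forall J, L J -> subd R I J -> J = I].

(** Levels are natural numbers, so some member of [L] containing [I] has least level. A member of
    [L] containing that one has the same level and meets it, hence equals it. *)
Lemma maxd_cover (L : set dyad) :
  exists f : dyad -> dyad, forall I, L I -> maxd L (f I) /\ subd R I (f I).
Proof.
suff cover I : exists K, L I -> maxd L K /\ subd R I K.
  by have [f fP] := choice cover; exists f.
have [LI|nLI] := pselect (L I); last by exists I.
pose above n := `[< exists2 K, L K & subd R I K /\ lvl K = n >].
have ex : exists n, above n.
  by exists (lvl I); apply/asboolP; exists I => //; split => // x.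
have [n /asboolP[K LK [IK Kn]] nmin] := ex_minnP ex.
exists K => _; split=> //; split=> // J LJ KJ.
have nJ : (n <= lvl J)%N.
  apply: nmin; apply/asboolP; exists J => //; split=> //.
  exact: subset_trans KJ.
have xK := dyad_nonempty K; have [_] := itv_meet (subd_lvl KJ) xK (KJ _ xK).
move=> lvlKJ; apply/esym; move: lvlKJ.
by apply; apply/eqP; rewrite eqn_leq Kn nJ -Kn subd_lvl.
Qed.

Lemma maxd_trivIset L : trivIset (maxd L) (itv R).
Proof.
move=> I J [LI maxI] [LJ maxJ] [x [Ix Jx]].
case/orP: (leq_total (lvl I) (lvl J)) => IJ.
- by apply: maxJ => //; have [] := itv_meet IJ Jx Ix.
- by apply/esym; apply: maxI => //; have [] := itv_meet IJ Ix Jx.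
Qed.

Lemma bigcup_maxd L :
  \bigcup_(I in maxd L) itv R I = \bigcup_(I in L) itv R I.
Proof.
apply/seteqP; split; first by move=> x [I [LI _] Ix]; exists I.
have [f fP] := maxd_cover L.
by move=> x [I /fP[mfI IfI] Ix]; exists (f I) => //; exact: IfI.
Qed.

Lemma starE_le (L : set dyad) (B : set R) : measurable B ->
  (forall I, L I -> itv R I `<=` B) -> ((star R L)%:E <= mu B)%E.
Proof.
move=> mB LB; rewrite starE le_measure ?inE//.
  by apply: measurable_bigcup_count => I _; exact: measurable_dyad.
by move=> x [I LI]; exact: LB.
Qed.

Lemma star_ge0 L : 0 <= star R L.
Proof. exact: fine_ge0. Qed.

Lemma len_le_star L I : L I -> len R I <= star R L.
Proof.
move=> LI; rewrite -lee_fin starE -lebesgue_measure_dyad le_measure ?inE//.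
- exact: measurable_dyad.
- by apply: measurable_bigcup_count => J _; exact: measurable_dyad.
- by move=> x Ix; exists I.
Qed.

Lemma star_le_esum L :
  ((star R L)%:E <= \esum_(I in L) (len R I)%:E)%E.
Proof.
rewrite starE; under eq_esum do rewrite -lebesgue_measure_dyad.
by apply: measure_bigcup_le_esum => I _; exact: measurable_dyad.
Qed.

Lemma esum_maxd_le_star L :
  (\esum_(I in maxd L) (len R I)%:E <= (star R L)%:E)%E.
Proof.
rewrite starE; under eq_esum do rewrite -lebesgue_measure_dyad.
apply: esum_measure_le; [|exact: maxd_trivIset| |].
- by move=> I _; exact: measurable_dyad.
- by apply: measurable_bigcup_count => J _; exact: measurable_dyad.
- by move=> I [LI _] x Ix; exists I.
Qed.

(** Group the intervals of [L] under the maximal ones containing them: each group weighs at most [a]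
    times the length of its maximal interval, and these are disjoint with union [L^*]. *)
Lemma esum_le_star (w : dyad -> R) (a : R) (L : set dyad) :
  (forall I, 0 <= w I) ->
  (forall J, (\esum_(I in [set I | subd R I J]) (w I * len R I)%:E
              <= (a * len R J)%:E)%E) ->
  (\esum_(I in L) (w I * len R I)%:E <= (a * star R L)%:E)%E.
Proof.
move=> w0 wa; have [f fP] := maxd_cover L.
have a0 : 0 <= a.
  pose J : dyad := exist _ (0, 0)%N isT.
  have := le_trans (esum_ge0 _) (wa J).
  rewrite lee_fin pmulr_lge0 ?len_gt0//; apply => I _.
  by rewrite lee_fin mulr_ge0// len_ge0.
rewrite (esum_fibers (P := maxd L) (f := f)); last 2 first.
- by move=> I /fP[].
- by move=> I _; rewrite lee_fin mulr_ge0// len_ge0.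
apply: (@le_trans _ _ (\esum_(J in maxd L) (a%:E * (len R J)%:E))%E).
  apply: le_esum => J _; rewrite -EFinM; apply: le_trans (wa J).
  by apply: le_esum_set => I [/fP[_ If] <-].
rewrite esumZl// ?EFinM; last by move=> I _; rewrite lee_fin len_ge0.
by rewrite lee_wpmul2l ?lee_fin ?esum_maxd_le_star.
Qed.

(** * Weights and Property P *)

(** This is [A(w) <= a]; it treats Carleson constants and squared BMO norms together. *)
Definition weight_le (w : dyad -> R) (a : R) : Prop :=
  forall J, (\esum_(I in [set I | subd R I J]) (w I * len R I)%:E
              <= (a * len R J)%:E)%E.

Lemma esum_ge_term (T : choiceType) (L : set T) (a : T -> \bar R) i :
  L i -> (0 <= a i)%E -> (a i <= \esum_(j in L) a j)%E.
Proof.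
move=> Li ai; rewrite -[leLHS](esum_set1 (t := i) (a := a))//.
by apply: le_esum_set => _ ->.
Qed.

Lemma weight_le_term w a I : (forall I, 0 <= w I) -> weight_le w a -> w I <= a.
Proof.
move=> w0 /(_ I) wa; rewrite -(ler_pM2r (len_gt0 I)) -lee_fin.
apply: le_trans wa; apply: (esum_ge_term (a := fun I => (w I * len R I)%:E)) => /=.
  by move=> x.
by rewrite lee_fin mulr_ge0// len_ge0.
Qed.

Lemma average_le (J : dyad) (s : \bar R) (a : R) :
  (((len R J)^-1)%:E * s <= a%:E)%E = (s <= (a * len R J)%:E)%E.
Proof. by rewrite lee_pdivrMl ?len_gt0// -EFinM mulrC. Qed.

Lemma carleson_leP (L : set dyad) (a : R) :
  (carleson R L <= a%:E)%E <->
  forall J, (\esum_(I in [set I | L I /\ subd R I J]) (len R I)%:E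
    <= (a * len R J)%:E)%E.
Proof.
split=> [La J|La].
  by rewrite -average_le; apply: le_trans La; apply: ereal_sup_ubound; exists J.
by apply: ge_ereal_sup => _ [J _ <-]; rewrite average_le.
Qed.

Lemma carleson_ge0 L : (0 <= carleson R L)%E.
Proof.
pose J : dyad := exist _ (0, 0)%N isT.
apply: (@le_trans _ _ (((len R J)^-1)%:E *
   (\esum_(I in [set I | L I /\ subd R I J]) (len R I)%:E))%E).
  rewrite mule_ge0 ?lee_fin ?invr_ge0 ?len_ge0// esum_ge0// => I _.
  by rewrite lee_fin len_ge0.
by apply: ereal_sup_ubound; exists J.
Qed.

Lemma carleson_weight (L : set dyad) (a : R) :
  (carleson R L <= a%:E)%E <-> weight_le (fun I => (I \in L)%:R) a.
Proof.
rewrite carleson_leP /weight_le.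
have E J : (\esum_(I in [set I | L I /\ subd R I J]) (len R I)%:E =
    \esum_(I in [set I | subd R I J]) ((I \in L)%:R * len R I)%:E)%E.
  rewrite (_ : [set I | _] = L `&` [set I | subd R I J])// esum_mkcondl.
  by apply: eq_esum => I _; case: ifPn => _; rewrite ?mul1r ?mul0r.
by split=> La J; [rewrite -E|rewrite E].
Qed.

Lemma esqrt_le (y : \bar R) (b : R) : 0 <= b ->
  (esqrt y <= b%:E)%E = (y <= (b ^+ 2)%:E)%E.
Proof.
move=> b0; case: y => [r| |] /=; rewrite ?leNye// ?lee_fin//.
have [r0|r0] := leP 0 r.
  by rewrite -[in RHS](sqr_sqrtr r0) ler_sqr// nnegrE sqrtr_ge0.
(* The root of a negative number is 0 by convention, so both inequalities hold. *)
rewrite ltr0_sqrtr// b0; apply/esym/idP; rewrite (le_trans (ltW r0))//.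
exact: sqr_ge0.
Qed.

Lemma bmo_norm_leP (x : dyad -> R) (b : R) : 0 <= b ->
  (bmo_norm x <= b%:E)%E <-> weight_le (fun I => x I ^+ 2) (b ^+ 2).
Proof.
move=> b0; split=> [xb J|xb].
  rewrite -average_le -esqrt_le//; apply: le_trans xb.
  by apply: ereal_sup_ubound; exists J.
by apply: ge_ereal_sup => _ [J _ <-]; rewrite esqrt_le// average_le.
Qed.

Lemma bmo_norm_ge0 (x : dyad -> R) : (0 <= bmo_norm x)%E.
Proof.
pose J : dyad := exist _ (0, 0)%N isT.
pose y := (((len R J)^-1)%:E *
   (\esum_(I in [set I | subd R I J]) (x I ^+ 2 * len R I)%:E))%E.
apply: (@le_trans _ _ (esqrt y)).
  by case: y => [r| |] //=; rewrite lee_fin sqrtr_ge0.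
by apply: ereal_sup_ubound; exists J.
Qed.

Lemma propP_weight (Dom : set dyad) (s : dyad -> dyad) :
  set_inj Dom s -> propP R Dom s ->
  exists C : R, 0 < C /\ forall w a, (forall I, 0 <= w I) -> weight_le w a ->
    forall J, (\esum_(I in [set I | Dom I /\ subd R (s I) J])
      (w I * len R (s I))%:E <= (C * a * len R J)%:E)%E.
Proof.
(* The first [M] pays for the intervals sent into the [E_i]. In the product, the factor [M] comes
   from (b) and the sum [M + M] from (c) and (a). *)
move=> sinj [M [M0 HP]]; exists (M + M * (M + M)); split.
  by rewrite addr_gt0// mulr_gt0// addr_gt0.
move=> w a w0 wa J.
have [Ls [Es [LD [U [_ [tE [_ [cE [rL sL]]]]]]]]] := HP J.
have a0 : 0 <= a.
  by apply: le_trans (weight_le_term J w0 wa); exact: w0.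
set E := \bigcup_i Es i in U cE.
have EJ : (\esum_(K in E) (len R K)%:E <= (M * len R J)%:E)%E.
  move/carleson_leP : cE => /(_ J); apply: le_trans; apply: le_esum_set.
  move=> K EK; split=> //; have : (\bigcup_i (s @` Ls i) `|` E) K by right.
  by rewrite -U => -[].
pose B := [set I | Dom I /\ E (s I)].
have nn I : (0 <= (w I * len R (s I))%:E)%E.
  by rewrite lee_fin mulr_ge0// len_ge0.
rewrite (esumID B)//.
rewrite -mulrA mulrDl EFinD leeD//.
  apply: (@le_trans _ _ (\esum_(I in B) (a%:E * (len R (s I))%:E))%E).
    apply: (@le_trans _ _ (\esum_(I in B) (w I * len R (s I))%:E)%E).
      by apply: le_esum_set => I [].
    apply: le_esum => I _; rewrite -EFinM lee_fin ler_wpM2r ?len_ge0//.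
    exact: weight_le_term.
  rewrite esumZl//; last by move=> I _; rewrite lee_fin len_ge0.
  rewrite -(esum_image B s (fun K => (len R K)%:E)); last first.
    by apply: sub_in2 sinj => I; rewrite !inE => -[].
  rewrite mulrCA EFinM lee_wpmul2l ?lee_fin//.
  apply: le_trans EJ; apply: le_esum_set => _ [I [_ EI] <-]; exact: EI.
(* An interval not sent into the [E_i] has its image in some [sigma(L_i)]; injectivity puts the
   interval itself in [L_i]. *)
have choose I : exists i, (Dom I /\ subd R (s I) J) /\ ~ B I -> Ls i I.
  have [[[DI IJ] nB]|h] := pselect ((Dom I /\ subd R (s I) J) /\ ~ B I); last first.
    by exists 0%N => /h.
  have : (\bigcup_i (s @` Ls i) `|` E) (s I) by rewrite -U; split=> //; exists I.
  case=> [[i _ [I' LI' sI]]|EI]; last by case: nB.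
  exists i => _; rewrite -(sinj I' I) ?inE//; exact: LD LI'.
have [f fP] := boolp.choice choose.
rewrite (esum_fibers (P := setT) (f := f))//.
have st0 L : 0 <= star R L := star_ge0 L.
apply: (@le_trans _ _ (\esum_(i in [set: nat]) ((a * M)%:E *
   ((star R (s @` Ls i))%:E + (star R (Es i))%:E)))%E).
  apply: le_esum => i _.
  set k := M * (star R (s @` Ls i) + star R (Es i)) / star R (Ls i).
  have k0 : 0 <= k by rewrite !mulr_ge0 ?invr_ge0 ?addr_ge0// ltW.
  apply: (@le_trans _ _ (\esum_(I in Ls i) (k%:E * (w I * len R I)%:E))%E).
    apply: (@le_trans _ _ (\esum_(I in Ls i) (w I * len R (s I))%:E)%E).
      by apply: le_esum_set => I [[/= QI nB] <-]; apply: fP.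
    apply: le_esum => I LI; rewrite -EFinM lee_fin mulrCA ler_wpM2l//.
    by rewrite -ler_pdivrMr ?len_gt0//; exact: rL.
  rewrite esumZl//; last by move=> I _; rewrite lee_fin mulr_ge0// len_ge0.
  apply: (@le_trans _ _ (k%:E * (a * star R (Ls i))%:E)%E).
    by rewrite lee_wpmul2l ?lee_fin//; exact: esum_le_star.
  rewrite -EFinD -!EFinM lee_fin /k.
  (* If [L_i] is empty, [k] divides by zero, but then the left side is zero as well. *)
  have [->|nz] := eqVneq (star R (Ls i)) 0.
    by rewrite !mulr0 !mulr_ge0 ?addr_ge0// ltW.
  by rewrite le_eqVlt; apply/orP; left; apply/eqP; field.
rewrite esumZl ?mulr_ge0 ?(ltW M0)//; last by move=> i _; rewrite adde_ge0 ?lee_fin.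
rewrite esumD; [|by move=> i _; rewrite lee_fin..].
rewrite -nneseries_esumT; last by move=> i; rewrite lee_fin.
rewrite (_ : M * (M + M) * (a * len R J) =
  (a * M) * (M * len R J + M * len R J)); last by ring.
rewrite (EFinM (a * M)) EFinD lee_wpmul2l ?lee_fin ?mulr_ge0 ?(ltW M0)//.
(* (c) bounds the sum of the [|sigma(L_i)^*|]. The [E_i] are disjoint, so the sum of the [|E_i^*|]
   is at most the total length of [E]. *)
rewrite leeD//; apply: le_trans EJ.
rewrite esum_bigcupT.
- by apply: le_esum => i _; exact: star_le_esum.
- move=> i j _ _ [x [xi xj]]; apply/eqP/negPn/negP => /eqP ij.
  by have := tE i j ij; rewrite -subset0 => /(_ x); apply.
- by move=> K; rewrite lee_fin len_ge0.
Qed.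

(** * The operator T acting on weights *)

Lemma Top_tau (tau : dyad -> dyad) (x : dyad -> R) I :
  injective tau -> Top tau x (tau I) = x I.
Proof.
move=> inj; rewrite /Top; case: pselect => [e|[]]; last by exists I.
by congr x; apply: inj; exact: (projT2 (cid e)).
Qed.

Lemma Top_notin (tau : dyad -> dyad) (x : dyad -> R) K :
  ~ range tau K -> Top tau x K = 0.
Proof.
move=> nK; rewrite /Top; case: pselect => // e; exfalso; apply: nK.
by case: e => I IK; exists I.
Qed.

Lemma tau_invK (tau : dyad -> dyad) I :
  injective tau -> tau_inv tau (tau I) = I.
Proof.
move=> inj; rewrite /tau_inv; case: pselect => [e|[]]; last by exists I.
by apply: inj; exact: (projT2 (cid e)).
Qed.

Lemma tau_inv_inj (tau : dyad -> dyad) : injective tau ->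
  set_inj (range tau) (tau_inv tau).
Proof.
by move=> inj _ _ /[!inE] -[I _ <-] [I' _ <-]; rewrite !tau_invK// => ->.
Qed.

Lemma Top_comp (tau : dyad -> dyad) (x : dyad -> R) (f : R -> R) K :
  f 0 = 0 -> Top tau (f \o x) K = f (Top tau x K).
Proof. by rewrite /Top; case: pselect. Qed.

Lemma esum_Top (tau : dyad -> dyad) (w c : dyad -> R) (L : set dyad) :
  injective tau ->
  (\esum_(K in L) (Top tau w K * c K)%:E =
   \esum_(I in [set I | L (tau I)]) (w I * c (tau I))%:E)%E.
Proof.
move=> inj.
rewrite (eq_esum (I := [set I | L (tau I)])
  (b := fun I => (Top tau w (tau I) * c (tau I))%:E)); last first.
  by move=> I _; rewrite Top_tau.
rewrite -(esum_image _ tau (fun K => (Top tau w K * c K)%:E)); last first.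
  by move=> I J _ _; exact: inj.
rewrite esum_mkcond [RHS]esum_mkcond; apply: eq_esum => K _.
case: ifPn => [|nL]; case: ifPn => //.
- rewrite !inE => nK LK; rewrite Top_notin ?mul0r// => -[I _ IK].
  by move/negP: nK; apply; rewrite inE; exists I => //=; rewrite IK.
- rewrite inE => -[I LI IK]; move/negP: nL => []; rewrite inE -IK; exact: LI.
Qed.

Definition weight_equiv (tau : dyad -> dyad) (C : R) :=
  forall w a, (forall I, 0 <= w I) ->
  (weight_le w a -> weight_le (Top tau w) (C * a)) /\
  (weight_le (Top tau w) a -> weight_le w (C * a)).

(** Property P of [tau] controls [Top tau w] by [w]. Property P of the inverse is applied to the
    weight [Top tau w], whose sums pull back to those of [w]. *)
Lemma propP_weight_equiv (tau : dyad -> dyad) : injective tau ->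
  propP R [set: dyad] tau -> propP R (range tau) (tau_inv tau) ->
  exists C : R, 0 < C /\ weight_equiv tau C.
Proof.
move=> inj P1 P2.
have [C1 [C10 H1]] := propP_weight (in2W inj) P1.
have [C2 [C20 H2]] := propP_weight (tau_inv_inj inj) P2.
exists (C1 + C2); split; first by rewrite addr_gt0.
have le1 a : 0 <= a -> C1 * a <= (C1 + C2) * a.
  by move=> a0; rewrite ler_wpM2r// lerDl ltW.
have le2 a : 0 <= a -> C2 * a <= (C1 + C2) * a.
  by move=> a0; rewrite ler_wpM2r// lerDr ltW.
move=> w a w0.
have Tw0 K : 0 <= Top tau w K.
  by rewrite /Top; case: pselect.
have pos v : (forall I, 0 <= v I) -> weight_le v a -> 0 <= a.
  by move=> v0 va; apply: le_trans (weight_le_term (exist _ (0, 0)%N isT) v0 va).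
split=> wa J.
  have a0 := pos _ w0 wa.
  rewrite (esum_Top _ _ _ inj); have := H1 _ _ w0 wa J.
  move=> /le_trans H; apply: le_trans (H _ _).
    by apply: le_esum_set => I.
  by rewrite lee_fin ler_wpM2r ?len_ge0// le1.
have a0 := pos _ Tw0 wa.
have := H2 _ _ Tw0 wa J; rewrite esum_Top// => H.
apply: le_trans (le_trans H _); last first.
  by rewrite lee_fin ler_wpM2r ?len_ge0// le2.
rewrite (_ : [set I | subd R I J] =
  [set I | [set K | range tau K /\ subd R (tau_inv tau K) J] (tau I)]).
  by apply: le_esum => I _; rewrite tau_invK.
apply/seteqP; split=> I /=; rewrite tau_invK//; last by case.
by move=> IJ; split=> //; exists I.
Qed.

(** * BMO norms and Carleson constants *)

Definition bmo_iso (tau : dyad -> dyad) : Prop :=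
  exists c : R, 1 <= c /\
      forall x : dyad -> R, (bmo_norm x < +oo)%E ->
        ((c^-1)%:E * bmo_norm x <= bmo_norm (Top tau x))%E /\
        (bmo_norm (Top tau x) <= c%:E * bmo_norm x)%E.

Definition carleson_equiv (tau : dyad -> dyad) : Prop :=
  exists M : R, 0 < M /\
      forall L : set dyad,
        ((M^-1)%:E * carleson R L <= carleson R (tau @` L))%E /\
        (carleson R (tau @` L) <= M%:E * carleson R L)%E.

Lemma weight_le_mono (w : dyad -> R) a b : a <= b -> weight_le w a -> weight_le w b.
Proof.
move=> ab wa J; apply: le_trans (wa J) _.
by rewrite lee_fin ler_wpM2r ?len_ge0.
Qed.

Lemma weight_equiv_bmo_iso (tau : dyad -> dyad) (C : R) :
  0 < C -> weight_equiv tau C -> bmo_iso tau.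
Proof.
(* Norms are roots of weight bounds, so a constant [c >= 1] with [C <= c ^+ 2] is needed. *)
move=> C0 HC; exists (C + 1); split; first by rewrite lerDr ltW.
have c0 : 0 < C + 1 by rewrite addr_gt0.
have sq (b : R) : C * b ^+ 2 <= ((C + 1) * b) ^+ 2.
  by rewrite exprMn ler_wpM2r ?sqr_ge0//; nra.
move=> x; have := bmo_norm_ge0 x.
case E : (bmo_norm x) => [b| |] // b0 _; rewrite lee_fin in b0.
have TE : Top tau (fun I => x I ^+ 2) = (fun K => Top tau x K ^+ 2).
  apply/funext => K; apply: (Top_comp tau x (f := fun y => y ^+ 2)).
  by rewrite expr0n.
have [h1 h2] := HC (fun I => x I ^+ 2) (b ^+ 2) (fun I => sqr_ge0 _).
split.
  rewrite lee_pdivrMl//; have := bmo_norm_ge0 (Top tau x).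
  case E' : (bmo_norm (Top tau x)) => [r| |] // r0; last first.
    by rewrite gt0_muley ?lte_fin// leey.
  rewrite lee_fin in r0.
  rewrite -EFinM -E; apply/bmo_norm_leP; first by rewrite mulr_ge0// ltW.
  apply: weight_le_mono (sq r) _.
  apply: (HC (fun I => x I ^+ 2) (r ^+ 2) (fun I => sqr_ge0 _)).2.
  by rewrite TE; apply/bmo_norm_leP; rewrite ?E'.
rewrite -EFinM; apply/bmo_norm_leP; first by rewrite mulr_ge0// ltW.
apply: weight_le_mono (sq b) _; rewrite -TE; apply: h1.
by apply/bmo_norm_leP; rewrite ?E.
Qed.

Lemma bmo_norm_indic (L : set dyad) (b : R) : 0 <= b ->
  (bmo_norm (fun I => (I \in L)%:R : R) <= b%:E)%E <->
  (carleson R L <= (b ^+ 2)%:E)%E.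
Proof.
move=> b0; rewrite bmo_norm_leP// carleson_weight.
rewrite (_ : (fun I => (I \in L)%:R ^+ 2) = (fun I => (I \in L)%:R))//.
by apply/funext => I; case: (I \in L); rewrite ?expr1n ?expr0n.
Qed.

Lemma Top_indic (tau : dyad -> dyad) (L : set dyad) : injective tau ->
  Top tau (fun I => (I \in L)%:R : R) = (fun K => (K \in tau @` L)%:R).
Proof.
move=> inj; apply/funext => K.
have [[I _ <-]|nK] := pselect (range tau K).
  rewrite Top_tau//; congr (nat_of_bool _)%:R; apply/idP/idP; rewrite !inE.
    by move=> LI; exists I.
  by move=> [I' LI' /inj <-].
rewrite Top_notin// memNset// => -[I LI IK]; apply: nK; by exists I.
Qed.

Lemma carleson_subset (L L' : set dyad) : L `<=` L' ->
  (carleson R L <= carleson R L')%E.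
Proof.
move=> LL'; apply: ge_ereal_sup => _ [J _ <-].
apply: (@le_trans _ _ (((len R J)^-1)%:E *
   (\esum_(I in [set I | L' I /\ subd R I J]) (len R I)%:E))%E).
  rewrite lee_wpmul2l ?lee_fin ?invr_ge0 ?len_ge0//.
  by apply: le_esum_set => I [/LL'].
by apply: ereal_sup_ubound; exists J.
Qed.

(** The cardinality of [X] is a bound, since an interval inside [J] is no longer than [J]. *)
Lemma carleson_finite (X : set dyad) : finite_set X ->
  exists2 a : R, 0 <= a & (carleson R X <= a%:E)%E.
Proof.
move=> finX; set n := (\esum_(I in X) 1%:E : \bar R)%E.
have n0 : (0 <= n)%E by apply: esum_ge0 => *; exact: lee01.
have nfin : n \is a fin_num.
  rewrite /n esum_fset//.
  by rewrite fsbig_finite// sumEFin.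
exists (fine n); first exact: fine_ge0.
apply/carleson_leP => J.
apply: (@le_trans _ _ (\esum_(I in X) ((len R J)%:E * 1%:E))%E).
  apply: (@le_trans _ _ (\esum_(I in [set I | X I /\ subd R I J])
      ((len R J)%:E * 1%:E))%E).
    by apply: le_esum => I [_ /subd_len]; rewrite mule1 lee_fin.
  by apply: le_esum_set => I [].
rewrite esumZl ?len_ge0//.
by rewrite mulrC EFinM fineK.
Qed.

Lemma carleson_le_finite (L : set dyad) (a : R) :
  (forall X, finite_set X -> X `<=` L -> (carleson R X <= a%:E)%E) ->
  (carleson R L <= a%:E)%E.
Proof.
move=> H; apply/carleson_leP => J; apply: ge_ereal_sup => _ [X [finX XL] <-].
have /carleson_leP/(_ J) := H X finX (fun I XI => (XL I XI).1).
apply: le_trans; apply: ereal_sup_ubound; exists X => //; split=> // I XI.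
by split=> //; have [] := XL I XI.
Qed.

Lemma bmo_iso_carleson_equiv (tau : dyad -> dyad) : injective tau ->
  bmo_iso tau -> carleson_equiv tau.
Proof.
move=> inj [c [c1 H]]; have c0 : 0 < c by apply: lt_le_trans c1.
have M0 : 0 < c ^+ 2 by rewrite exprn_gt0.
(* The Carleson constant is the square of the BMO norm of the indicator. *)
exists (c ^+ 2); split=> // L; split.
  rewrite lee_pdivrMl//; have := carleson_ge0 (tau @` L).
  case E : (carleson R (tau @` L)) => [r| |] // r0; last first.
    by rewrite gt0_muley ?lte_fin// leey.
  (* (i) concerns only [x] of finite norm, while the Carleson constant of [L] might be infinite.
     Finite subsets of [L] are admissible, and their bound [c ^+ 2 * r] is uniform. *)
  rewrite lee_fin in r0; rewrite -EFinM; apply: carleson_le_finite => X finX XL.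
  have [a a0 Xa] := carleson_finite finX.
  rewrite -(sqr_sqrtr r0) -exprMn.
  have s0 : 0 <= Num.sqrt r by rewrite sqrtr_ge0.
  apply/bmo_norm_indic; first by rewrite mulr_ge0// ltW.
  have [] := H (fun I => (I \in X)%:R).
    apply: (@le_lt_trans _ _ (Num.sqrt a)%:E); last by rewrite ltry.
    by apply/bmo_norm_indic; rewrite ?sqrtr_ge0// sqr_sqrtr.
  rewrite lee_pdivrMl// Top_indic// => h _; apply: le_trans h _.
  rewrite EFinM lee_wpmul2l ?lee_fin ?(ltW c0)//; apply/bmo_norm_indic => //.
  by rewrite sqr_sqrtr// -E; apply: carleson_subset; exact: image_subset.
have := carleson_ge0 L.
case E : (carleson R L) => [r| |] // r0; last first.
  by rewrite gt0_muley ?lte_fin// leey.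
rewrite lee_fin in r0; have s0 : 0 <= Num.sqrt r by rewrite sqrtr_ge0.
have Lr : (bmo_norm (fun I => (I \in L)%:R : R) <= (Num.sqrt r)%:E)%E.
  by apply/bmo_norm_indic; rewrite // sqr_sqrtr// E.
have [_] := H (fun I => (I \in L)%:R) (le_lt_trans Lr (ltry _)).
rewrite Top_indic// -EFinM -(sqr_sqrtr r0) -exprMn => h.
apply/bmo_norm_indic; first by rewrite mulr_ge0// ltW.
by apply: le_trans h _; rewrite EFinM lee_wpmul2l ?lee_fin ?(ltW c0).
Qed.

(** * Good intervals *)

Lemma carleson_maxd (L : set dyad) : (carleson R (maxd L) <= 1%:E)%E.
Proof.
apply/carleson_leP => J; rewrite mul1r -lebesgue_measure_dyad.
under eq_esum do rewrite -lebesgue_measure_dyad.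
apply: esum_measure_le.
- by move=> I _; exact: measurable_dyad.
- by apply: sub_trivIset (maxd_trivIset (L := L)) => I [].
- exact: measurable_dyad.
- by move=> I [].
Qed.

Lemma esum_len_le_star (L : set dyad) (a : R) : (carleson R L <= a%:E)%E ->
  (\esum_(I in L) (len R I)%:E <= (a * star R L)%:E)%E.
Proof.
move/carleson_weight => La.
apply: le_trans (esum_le_star L (fun I => ler0n _ _) La).
by apply: le_esum => I LI; rewrite mem_set// mul1r.
Qed.

Lemma star_subset (L L' : set dyad) : L `<=` L' -> star R L <= star R L'.
Proof.
move=> LL'; rewrite -lee_fin [leRHS]starE; apply: starE_le.
  by apply: measurable_bigcup_count => I _; exact: measurable_dyad.
by move=> I /LL' LI x Ix; exists I.
Qed.

Lemma star_le_maxd (L : set dyad) :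
  ((star R L)%:E <= \esum_(I in maxd L) (len R I)%:E)%E.
Proof. by rewrite starE -bigcup_maxd -starE; exact: star_le_esum. Qed.

(** The halves of (ii) are stated separately, for a map on [Dom], because they trade places when
    [tau] is replaced by its inverse. *)
Definition carleson_le (Dom : set dyad) (s : dyad -> dyad) (M : R) : Prop :=
  forall (L : set dyad) (a : R), L `<=` Dom -> (carleson R L <= a%:E)%E ->
    (carleson R (s @` L) <= (M * a)%:E)%E.

Definition carleson_ge (Dom : set dyad) (s : dyad -> dyad) (M : R) : Prop :=
  forall (L : set dyad) (a : R), L `<=` Dom -> (carleson R (s @` L) <= a%:E)%E ->
    (carleson R L <= (M * a)%:E)%E.

Section Selection.
Variables (Dom : set dyad) (s : dyad -> dyad) (M : R).
Hypotheses (M0 : 0 < M) (sinj : set_inj Dom s) (sle : carleson_le Dom s M).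

Lemma esum_image_len (L : set dyad) : L `<=` Dom ->
  (\esum_(I in L) (len R (s I))%:E = \esum_(K in s @` L) (len R K)%:E)%E.
Proof.
move=> LD; rewrite (esum_image _ _ (fun K => (len R K)%:E))//.
by apply: sub_in2 sinj => I; rewrite !inE; exact: LD.
Qed.

(** The maximal intervals of [L] have total length [|L^*|] and Carleson constant at most 1. Their
    images then have Carleson constant at most [M], hence total length at most [M |s(L)^*|]. *)
Lemma star_image_ge (L : set dyad) (q : R) : 0 <= q -> L `<=` Dom ->
  (forall I, L I -> q * len R I <= len R (s I)) ->
  q * star R L <= M * star R (s @` L).
Proof.
move=> q0 LD qL; rewrite -lee_fin EFinM.
apply: (@le_trans _ _ (q%:E * \esum_(I in maxd L) (len R I)%:E)%E).
  by rewrite lee_wpmul2l ?lee_fin// star_le_maxd.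
rewrite -esumZl//; last by move=> I _; rewrite lee_fin len_ge0.
apply: (@le_trans _ _ (\esum_(I in maxd L) (len R (s I))%:E)%E).
  by apply: le_esum => I [LI _]; rewrite -EFinM lee_fin qL.
have AD : maxd L `<=` Dom by move=> I [/LD].
rewrite esum_image_len//.
have := sle AD (carleson_maxd L); rewrite mulr1 => /esum_len_le_star.
move=> /le_trans; apply; rewrite lee_fin ler_wpM2l ?(ltW M0)// star_subset//.
by apply: image_subset => I [].
Qed.

(** Here the maximal intervals are taken in the image and pulled back: by [sge] their preimages have
    Carleson constant at most [M]. *)
Lemma star_image_le (L : set dyad) (q : R) : carleson_ge Dom s M ->
  0 <= q -> L `<=` Dom -> (forall I, L I -> len R (s I) <= q * len R I) ->
  star R (s @` L) <= q * (M * star R L).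
Proof.
move=> sge q0 LD qL; set B := maxd (s @` L).
pose B' := [set I | L I /\ B (s I)].
have B'D : B' `<=` Dom by move=> I [/LD].
have sB' : s @` B' = B.
  apply/seteqP; split=> [_ [I [_ BI] <-]//|K BK].
  by have [[I LI IK] _] := BK; exists I => //; split=> //; rewrite IK.
have cB' : (carleson R B' <= M%:E)%E.
  by rewrite -[M]mulr1; apply: sge => //; rewrite sB'; exact: carleson_maxd.
rewrite -lee_fin; apply: le_trans (star_le_maxd _) _.
rewrite -/B -sB' -esum_image_len//.
apply: (@le_trans _ _ (\esum_(I in B') (q%:E * (len R I)%:E))%E).
  by apply: le_esum => I [LI _]; rewrite -EFinM lee_fin qL.
rewrite esumZl//; last by move=> I _; rewrite lee_fin len_ge0.
rewrite EFinM lee_wpmul2l ?lee_fin//.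
apply: le_trans (esum_len_le_star cB') _.
by rewrite lee_fin ler_wpM2l ?(ltW M0)// star_subset// => I [].
Qed.

(* The term with 8 * 4 ^- T strengthens the statement to make it inductive. *)
Lemma geometric_absorption (u g : nat -> R) T :
  (forall d, u d <= g d + 2 * \sum_(j < d) u j) ->
  \sum_(d < T) 4 ^- d * u d + 8 * 4 ^- T * (\sum_(d < T) u d)
    <= 3 * \sum_(d < T) 4 ^- d * g d.
Proof.
move=> H; elim: T => [|T IH]; first by rewrite !big_ord0 !mulr0 addr0.
rewrite !big_ord_recr /= [leRHS]mulrDr; apply: (le_trans _ (lerD IH (lexx _))).
have := H T; set t := \sum_(j < T) u j; set W := \sum_(d < T) _ * u d => HT.
have p0 : 0 < (4 : R) ^- T by rewrite invr_gt0 exprn_gt0.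
rewrite exprS invfM; set p := 4 ^- T in p0 *.
have : p * (u T) <= p * (g T + 2 * t) by rewrite ler_wpM2l// ltW.
(* The left side is now [W + 3 p u_T + 2 p t], and [H] gives [3 p u_T <= 3 p g_T + 6 p t]; the total
   [8 p t] is the extra term of the hypothesis [IH]. *)
have -> : 8 * (4^-1 * p) * (t + u T) = 2 * (p * t) + 2 * (p * u T) :> R by field.
lra.
Qed.

(* [D d] stands for the class C_(n-1-d), so that larger ratios come first. *)
Lemma layered_star_sum (J : dyad) (q : R) (D : nat -> set dyad) T :
  0 <= q -> (forall d, D d `<=` Dom) -> trivIset setT D ->
  (forall d I, D d I -> subd R (s I) J) ->
  (forall d I, D d I -> q * 4 ^- d * len R I <= len R (s I)) ->
  \sum_(d < T) q * 4 ^- d * star R (D d) <= 6 * M * len R J.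
Proof.
move=> q0 DD tD DJ Dq.
pose V d := \bigcup_(I in D d) itv R I.
pose U d := \big[setU/set0]_(j < d) V j.
have mV d : measurable (V d).
  by apply: measurable_bigcup_count => I _; exact: measurable_dyad.
have mU d : measurable (U d) by apply: bigsetU_measurable => j _; exact: mV.
pose good d := [set I | maxd (D d) I /\
  (2%:E * mu (itv R I `&` U d) <= (len R I)%:E)%E].
pose G := \bigcup_d good d.
have mIU I d : measurable (itv R I `&` U d).
  by apply: measurableI => //; exact: measurable_dyad.
have finIU I d : mu (itv R I `&` U d) \is a fin_num.
  rewrite ge0_fin_numE//; apply: (@le_lt_trans _ _ (mu (itv R I))).
    by apply: le_measure; rewrite ?inE; [exact: mIU|exact: measurable_dyad|move=> x []].
  by rewrite lebesgue_measure_dyad ltry.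
have goodD d : good d `<=` D d by move=> I [[]].
have GD : G `<=` Dom by move=> I [d _ /goodD /DD].
have choose I : exists d, G I -> good d I.
  have [[d _ gI]|nG] := pselect (G I); first by exists d.
  by exists 0%N => /nG.
have [f fP] := boolp.choice choose.
(* [F I] is the part of [I] not covered by the layers before that of [I]. *)
pose F I := itv R I `\` U (f I).
have mF I : measurable (F I) by apply: measurableD => //; exact: measurable_dyad.
(* For different layers, the later set avoids the whole earlier layer; within one layer, maximal
   intervals are disjoint. *)
have tF : trivIset G F.
  have lt I I' x : G I -> G I' -> F I x -> F I' x -> ~ (f I < f I')%N.
    move=> GI GI' [Ix _] [_ nU] ff; apply: nU; rewrite /U -bigcup_mkord.
    by exists (f I) => //; exists I => //; apply: goodD; exact: fP.
  move=> I I' GI GI' [x [FI FI']].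
  have [ff|ff|ff] := ltngtP (f I) (f I').
  - by case: (lt _ _ _ GI GI' FI FI').
  - by case: (lt _ _ _ GI' GI FI' FI).
  - have [mI _] := fP I GI; have [mI' _] := fP I' GI'.
    rewrite -ff in mI'; apply: (maxd_trivIset mI mI').
    by exists x; split; [case: FI|case: FI'].
have F_large I : G I -> ((len R I)%:E <= 2%:E * mu (F I))%E.
  move=> GI; have [_] := fP I GI.
  have -> : mu (F I) = (mu (itv R I) - mu (itv R I `&` U (f I)))%E.
    have fin : (mu (itv R I) < +oo)%E by rewrite lebesgue_measure_dyad ltry.
    by apply: measureD; [exact: measurable_dyad|exact: mU|exact: fin].
  rewrite lebesgue_measure_dyad; move: (finIU I (f I)).
  case: (mu (itv R I `&` U (f I))) => [m| |] //= _.
  by rewrite -EFinB -!EFinM !lee_fin; lra.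
have cG : (carleson R G <= 2%:E)%E.
  apply/carleson_leP => J'.
  apply: (@le_trans _ _ (\esum_(I in [set I | G I /\ subd R I J'])
      (2%:E * mu (F I)))%E); first by apply: le_esum => I [/F_large].
  rewrite esumZl// EFinM lee_wpmul2l// -lebesgue_measure_dyad.
  apply: esum_measure_le.
  - by move=> I _; exact: mF.
  - by apply: sub_trivIset tF => I [].
  - exact: measurable_dyad.
  - by move=> I [_ IJ] x [/IJ].
have sumG : (\esum_(I in G) (len R (s I))%:E <= (M * 2 * len R J)%:E)%E.
  rewrite esum_image_len//.
  have /carleson_leP/(_ J) := sle GD cG; apply: le_trans.
  by apply: le_esum_set => _ [I GI <-]; split;
    [exists I|apply: (DJ (f I)); apply: goodD; exact: fP].
pose e d := (\esum_(I in good d) (len R I)%:E)%E.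
have e_ge0 d : (0 <= e d)%E by apply: esum_ge0 => I _; rewrite lee_fin len_ge0.
have e_fin d : e d \is a fin_num.
  rewrite ge0_fin_numE//; apply: (@le_lt_trans _ _ (star R (D d))%:E).
    by apply: le_trans (esum_maxd_le_star _); apply: le_esum_set => I [].
  by rewrite ltry.
pose g d := fine (e d).
(* The ratio bound of layer [d] turns lengths of good intervals into lengths of their images, which
   [sumG] bounds over all layers at once. *)
have sumg : \sum_(d < T) q * 4 ^- d * g d <= M * 2 * len R J.
  rewrite -lee_fin; apply: le_trans sumG.
  rewrite /G esum_bigcupT//; last 2 first.
  - move=> i j _ _ [I [Ii Ij]]; apply: (tD i j) => //; exists I; split; exact: goodD.
  - by move=> I; rewrite lee_fin len_ge0.
  rewrite -nneseries_esumT; last first.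
    by move=> d; apply: esum_ge0 => I _; rewrite lee_fin len_ge0.
  apply: (@le_trans _ _ (\sum_(0 <= d < T) \esum_(I in good d) (len R (s I))%:E)%E);
    last first.
    apply: nneseries_lim_ge => d _ _; apply: esum_ge0 => I _.
    by rewrite lee_fin len_ge0.
  rewrite big_mkord -sumEFin; apply: lee_sum => d _.
  have qd : 0 <= q * 4 ^- d by rewrite mulr_ge0 ?invr_ge0 ?exprn_ge0.
  rewrite EFinM /g fineK// /e -esumZl//; last by move=> I _; rewrite lee_fin len_ge0.
  by apply: le_esum => I /goodD DI; rewrite -EFinM lee_fin; exact: Dq.
(* A bad maximal interval is shorter than twice its part in [U d]. These parts are disjoint, so the
   bad intervals total at most [2 |U d|]. *)
have rec d : star R (D d) <= g d + 2 * \sum_(j < d) star R (D j).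
  rewrite -lee_fin; apply: le_trans (star_le_maxd _) _.
  rewrite (esumID (good d)); last by move=> I _; rewrite lee_fin len_ge0.
  rewrite EFinD leeD//.
    by rewrite /g fineK//; apply: le_esum_set => I [].
  apply: (@le_trans _ _ (\esum_(I in maxd (D d) `&` ~` good d)
     (2%:E * mu (itv R I `&` U d)))%E).
    apply: le_esum => I [mI nI]; rewrite leNgt; apply/negP => h; apply: nI.
    by split=> //; exact: ltW.
  rewrite esumZl// EFinM lee_wpmul2l//.
  apply: (@le_trans _ _ (mu (U d))).
    apply: esum_measure_le.
    - by move=> I _; exact: mIU.
    - move=> I I' [mI _] [mI' _] [x [[xI _] [xI' _]]].
      by apply: (maxd_trivIset mI mI'); exists x.
    - exact: mU.
    - by move=> I _ x [].
  apply: (@le_trans _ _ (\sum_(j < d) mu (V j))%E).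
    by apply: Boole_inequality => j _; exact: mV.
  by rewrite -sumEFin; apply: lee_sum => j _; rewrite starE.
have := geometric_absorption T rec.
have E (v : nat -> R) : \sum_(d < T) q * 4 ^- d * v d =
    q * \sum_(d < T) 4 ^- d * v d.
  by rewrite mulr_sumr; apply: eq_bigr => d _; rewrite mulrA.
move: sumg; rewrite (E g) (E (fun d => star R (D d))) => sumg abs.
have t0 : 0 <= 8 * 4 ^- T * (\sum_(d < T) star R (D d)).
  by rewrite !mulr_ge0 ?invr_ge0 ?exprn_ge0// sumr_ge0// => d _; exact: star_ge0.
have abs' : \sum_(d < T) 4 ^- d * star R (D d) <= 3 * \sum_(d < T) 4 ^- d * g d.
  by apply: le_trans abs; rewrite lerDl.
rewrite (le_trans (ler_wpM2l q0 abs'))// mulrCA.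
(* The 3 comes from [geometric_absorption], the 2 from the Carleson constant of [G]. *)
have -> : 6 * M * len R J = 3 * (M * 2 * len R J) by ring.
by rewrite ler_wpM2l.
Qed.

End Selection.

(** * Classes of comparable ratios *)

(* Enumerates the integers as 0, -1, 1, -2, 2, ... so that the classes, which
   are indexed by integers, can be listed as the sequence Property P asks for. *)
Definition zigzag (i : nat) : int := if odd i then Negz i./2 else Posz i./2.

Lemma zigzag_inj : injective zigzag.
Proof.
move=> i j; rewrite /zigzag => ij.
rewrite -(odd_double_half i) -(odd_double_half j).
by move: ij; case: (odd i); case: (odd j) => // -[->].
Qed.

Lemma zigzag_surj k : exists i, zigzag i = k.
Proof.
case: k => n; [exists n.*2|exists n.*2.+1].
- by rewrite /zigzag odd_double doubleK.
- by rewrite /zigzag /= odd_double /= uphalf_double.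
Qed.

(** Both sides run over the integers from [-n] to [n - 1]; the right side lists them downwards, the
    order of the layers in [layered_star_sum]. *)
Lemma sum_zigzag (G : int -> R) n :
  \sum_(i < n.*2) G (zigzag i) = \sum_(d < n.*2) G (n%:Z - 1 - d%:Z).
Proof.
elim: n => [|n IH]; first by rewrite !big_ord0.
rewrite doubleS 2!big_ord_recr /= IH big_ord_recl big_ord_recr /=.
rewrite {1}/zigzag odd_double doubleK /zigzag /= odd_double /= uphalf_double.
rewrite addrAC addrC; congr (G _ + _); first by lia.
congr (_ + G _); last by rewrite /bump /=; lia.
by apply: eq_bigr => d _; congr G; rewrite /bump /=; lia.
Qed.

(** These are the classes [C_k]. The base 4 exceeds 3, the factor by which partial sums can grow at
    each step of the recursion in [geometric_absorption]. *)
Definition ratio_class (Dom : set dyad) (s : dyad -> dyad) (J : dyad) (k : int) :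
    set dyad :=
  [set I | [/\ Dom I, subd R (s I) J, 4 ^ k * len R I <= len R (s I)
             & len R (s I) < 4 ^ (k + 1) * len R I]].

(** The ratio is [2 ^ e] with [e] the difference of levels, so [k] is the floor of [e / 2]. *)
Lemma ratio_class_exists (I K : dyad) :
  exists k : int, 4 ^ k * len R I <= len R K /\ len R K < 4 ^ (k + 1) * len R I.
Proof.
pose e : int := (lvl I)%:Z - (lvl K)%:Z.
have two : (2 : R) != 0 by rewrite pnatr_eq0.
have lenK : len R K = 2 ^ e * len R I.
  rewrite /len -!/(lvl _) /e expfzDr// -exprnN -exprnP mulrAC mulfV ?mul1r//.
have four (k : int) : (4 : R) ^ k = 2 ^ (2 * k).
  by rewrite -exprz_exp; congr (_ ^ _); rewrite -exprnP expr2 -natrM.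
exists (e %/ 2)%Z; rewrite lenK !four.
have := divz_eq e 2; have := modz_ge0 e (isT : (2 : int) != 0).
have := ltz_mod e (isT : (2 : int) != 0) => h1 h2 h3.
by rewrite ler_pM2r ?len_gt0// ltr_pM2r ?len_gt0// ler_eXz2l ?ltr_eXz2l ?ltr1n//; lia.
Qed.

Lemma ratio_class_trivIset Dom s J : trivIset setT (ratio_class Dom s J).
Proof.
have lt (k l : int) I : ratio_class Dom s J k I -> ratio_class Dom s J l I -> ~ k < l.
  move=> [_ _ _ h1] [_ _ h2 _] kl.
  have := le_lt_trans h2 h1; rewrite ltr_pM2r ?len_gt0//.
  by rewrite ltr_eXz2l ?ltr1n//; lia.
move=> k l _ _ [I [kI lI]].
by have [kl|kl|//] := ltgtP k l; [case: (lt _ _ _ kI lI)|case: (lt _ _ _ lI kI)].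
Qed.

Lemma carleson0 : carleson R set0 = 0%E.
Proof.
apply/eqP; rewrite eq_le carleson_ge0 andbT; apply/carleson_leP => J.
rewrite (_ : [set I | _] = set0) ?esum_set0 ?mul0r//.
by apply/seteqP; split=> I // [].
Qed.

Lemma carleson_propP (Dom : set dyad) (s : dyad -> dyad) (M : R) :
  0 < M -> set_inj Dom s -> carleson_le Dom s M -> carleson_ge Dom s M ->
  propP R Dom s.
Proof.
(* [4 * M] serves (b), where 4 is the width of a class; [24 * M ^+ 2], which is [4 * M] times
   [6 * M], serves (c). *)
move=> M0 sinj sle sge; exists (4 * M + 24 * M ^+ 2); split.
  by rewrite addr_gt0 ?mulr_gt0 ?exprn_gt0.
have N0 : 0 <= 4 * M + 24 * M ^+ 2 by rewrite addr_ge0 ?mulr_ge0 ?sqr_ge0 ?(ltW M0).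
move=> J; set Q := ratio_class Dom s J.
have q0 k : 0 < (4 : R) ^ k by rewrite exprz_gt0.
have QD k : Q k `<=` Dom by move=> I [].
exists (fun i => Q (zigzag i)), (fun=> set0); split; first by move=> i; exact: QD.
split.
  rewrite (bigcup0 (F := fun=> set0))// setU0; apply/seteqP; split.
    move=> _ [[I DI <-] IJ]; have [k [k1 k2]] := ratio_class_exists I (s I).
    have [i ik] := zigzag_surj k; exists i => //; exists I => //.
    by rewrite ik.
  by move=> _ [i _ [I [DI IJ _ _] <-]]; split=> //; exists I.
split.
  move=> i j ij; apply/seteqP; split=> // _ [[I QI <-] [I' QI' II']].
  apply: ij; apply: zigzag_inj; apply: (@ratio_class_trivIset Dom s J) => //.
  exists I; split=> //; rewrite -(sinj I' I) ?inE//; [exact: QD QI'|exact: QD QI].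
split; first by move=> *; rewrite setI0.
split; first by move=> *; rewrite setI0.
split; first by rewrite bigcup0// carleson0 lee_fin.
split.
  move=> i I QI; set k := zigzag i in QI *.
  have [_ _ _ Ik] := QI.
  have st0 : 0 < star R (Q k) by apply: lt_le_trans (len_le_star QI); exact: len_gt0.
  have h : 4 ^ k * star R (Q k) <= M * star R (s @` Q k).
    apply: (star_image_ge M0 sinj sle); [exact: ltW|exact: QD|].
    by move=> K [].
  rewrite ler_pdivlMr// mulrAC ler_pdivrMr ?len_gt0//.
  have s0 := star_ge0 (s @` Q k); have s00 := star_ge0 set0.
  apply: (@le_trans _ _ (4 * (M * star R (s @` Q k)) * len R I)).
    apply: (@le_trans _ _ (4 ^ (k + 1) * len R I * star R (Q k))).
      by rewrite ler_wpM2r ?ltW.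
    rewrite expfzDr// expr1z; have := ler_wpM2r (len_ge0 I) h.
    nra.
  rewrite ler_wpM2r ?len_ge0// mulrA.
  apply: ler_pM; rewrite ?mulr_ge0 ?(ltW M0)//.
    by rewrite lerDl mulr_ge0// sqr_ge0.
  by rewrite lerDl.
apply: lime_le; first by apply: is_cvg_nneseries => i _ _; rewrite lee_fin star_ge0.
apply: nearW => n.
(* Passing to [n.*2] terms makes the indices fill a whole interval of integers. *)
apply: (@le_trans _ _ (\sum_(0 <= i < n.*2) (star R (s @` Q (zigzag i)))%:E)%E).
  rewrite [leRHS](@big_cat_nat _ _ _ n)//=; last by rewrite -addnn leq_addr.
  by rewrite leeDl// sume_ge0// => i _; rewrite lee_fin star_ge0.
rewrite big_mkord sumEFin lee_fin (sum_zigzag (fun k => star R (s @` Q k))).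
have Qle k : star R (s @` Q k) <= 4 * M * (4 ^ k * star R (Q k)).
  have -> : 4 * M * (4 ^ k * star R (Q k)) = 4 ^ (k + 1) * (M * star R (Q k)).
    by rewrite expfzDr// expr1z; ring.
  apply: (star_image_le M0 sinj sge); [exact: ltW|exact: QD|].
  by move=> I [_ _ _ /ltW].
(* Layer 0 is the class of index [n - 1], the largest in the sum, and [q] is its lower ratio
   bound. *)
pose q : R := 4 ^ (n%:Z - 1).
have qd (d : nat) : q * 4 ^- d = 4 ^ (n%:Z - 1 - d%:Z).
  by rewrite [RHS]expfzDr// exprnN.
have tQ : trivIset setT (fun d : nat => Q (n%:Z - 1 - d%:Z)).
  move=> d d' _ _ /(@ratio_class_trivIset Dom s J _ _ I I); lia.
have h : \sum_(d < n.*2) q * 4 ^- d * star R (Q (n%:Z - 1 - d%:Z)) <= 6 * M * len R J.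
  apply: (layered_star_sum sinj sle (D := fun d : nat => Q (n%:Z - 1 - d%:Z))).
  - exact/ltW/q0.
  - by move=> d; exact: QD.
  - exact: tQ.
  - by move=> d I [].
  - by move=> d I []; rewrite qd.
apply: (@le_trans _ _ (4 * M *
    \sum_(d < n.*2) q * 4 ^- d * star R (Q (n%:Z - 1 - d%:Z)))).
  by rewrite mulr_sumr; apply: ler_sum => d _; rewrite qd; exact: Qle.
apply: (le_trans (ler_wpM2l _ h)); first by rewrite mulr_ge0 ?(ltW M0).
have -> : 4 * M * (6 * M * len R J) = 24 * M ^+ 2 * len R J by ring.
by rewrite ler_wpM2r ?len_ge0// lerDr mulr_ge0 ?(ltW M0).
Qed.

Lemma carleson_equiv_propP (tau : dyad -> dyad) : injective tau ->
  carleson_equiv tau ->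
  propP R [set: dyad] tau /\ propP R (range tau) (tau_inv tau).
Proof.
move=> inj [M [M0 H]].
have up L a : (carleson R L <= a%:E)%E -> (carleson R (tau @` L) <= (M * a)%:E)%E.
  move=> La; apply: le_trans (proj2 (H L)) _.
  by rewrite EFinM lee_wpmul2l ?lee_fin ?(ltW M0).
have down L a : (carleson R (tau @` L) <= a%:E)%E -> (carleson R L <= (M * a)%:E)%E.
  move=> La; have := proj1 (H L); rewrite lee_pdivrMl// => /le_trans; apply.
  by rewrite EFinM lee_wpmul2l ?lee_fin ?(ltW M0).
(* With this identity, [down] for [tau] becomes the upper bound for [tau_inv], and [up] the lower
   one. *)
have invL L : L `<=` range tau -> tau @` (tau_inv tau @` L) = L.
  move=> Lr; apply/seteqP; split=> [_ [_ [K LK <-] <-]|K LK].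
    by have [I _ IK] := Lr K LK; rewrite -IK tau_invK// IK.
  have [I _ IK] := Lr K LK; exists I => //; exists K => //.
  by rewrite -IK tau_invK.
split; apply: (carleson_propP M0).
- exact: in2W.
- by move=> L a _; exact: up.
- by move=> L a _; exact: down.
- exact: tau_inv_inj.
- by move=> L a Lr La; apply: down; rewrite invL.
- by move=> L a Lr La; rewrite -(invL L Lr); exact: up.
Qed.

End Rearrangements.

Theorem theorem1 (R : realType) (tau : dyad -> dyad) (htau : injective tau) :
  let i_ := exists c : R, 1 <= c /\
      forall x : dyad -> R, (bmo_norm x < +oo)%E ->
        ((c^-1)%:E * bmo_norm x <= bmo_norm (Top tau x))%E /\
        (bmo_norm (Top tau x) <= c%:E * bmo_norm x)%E in
  let ii_ := exists M : R, 0 < M /\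
      forall L : set dyad,
        ((M^-1)%:E * carleson R L <= carleson R (tau @` L))%E /\
        (carleson R (tau @` L) <= M%:E * carleson R L)%E in
  let iii_ := propP R [set: dyad] tau /\ propP R (range tau) (tau_inv tau) in
  (i_ <-> ii_) /\ (ii_ <-> iii_).
Proof.
move=> i_ ii_ iii_.
have i_ii : i_ -> ii_ := bmo_iso_carleson_equiv htau.
have ii_iii : ii_ -> iii_ := carleson_equiv_propP htau.
have iii_i : iii_ -> i_.
  move=> [P1 P2]; have [C [C0 HC]] := propP_weight_equiv htau P1 P2.
  exact: weight_equiv_bmo_iso C0 HC.
by split; split; auto.
Qed.
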